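(* Let $(\Omega,\mathcal{F},\mathbb{P})$ be a nonatomic probability space and let $(\Phi,\Psi)$ be an Orlicz pair as in the context. The following statements are equivalent: (1a) every proper, convex, law-invariant functional $\rho:L^\Phi\to(-\infty,\infty]$ that is norm lower semicontinuous (with respect to $\|\cdot\|_\Phi$) has the Fatou property; (1b) every proper, quasiconvex, law-invariant functional $\rho:L^\Phi\to(-\infty,\infty]$ that is norm lower semicontinuous has the Fatou property; (2) $\Phi$ satisfies the $\Delta_2$ condition.
   Context: $(\Omega,\mathcal{F},\mathbb{P})$ is a nonatomic probability space; random variables are identified up to a.s. equality. An Orlicz function is a convex, increasing $\Phi:[0,\infty)\to[0,\infty)$ with $\Phi(0)=0$; its conjugate is $\Psi(s)=\sup_{t\ge0}(ts-\Phi(t))$. Standing assumption: $\Phi(t)>0$ for $t>0$ and $\lim_{t\to\infty}\Phi(t)/t=\infty$. $L^\Phi$ is the space of random variables $X$ with $\|X\|_\Phi:=\inf\{\lambda>0:\mathbb{E}[\Phi(|X|/\lambda)]\le 1\}<\infty$ (a Banach space with this norm). $\Phi$ is $\Delta_2$ if there exist $t_0\in(0,\infty)$ and $k\in\mathbb{R}$ with $\Phi(2t)<k\Phi(t)$ for all $t\ge t_0$. A functional is proper if not identically $\infty$; quasiconvex if all sublevel sets $\{\rho\le\lambda\}$ are convex; law-invariant if $\rho(X)=\rho(Y)$ whenever $X,Y$ have the same law. $\rho$ has the Fatou property if whenever $X_n\to X$ a.s. and $|X_n|\le Y$ for some $Y\in L^\Phi$ and all $n$, then $\rho(X)\le\liminf_n\rho(X_n)$.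 *)

(* Defs.v *)
From HB Require Import structures.
From mathcomp Require Import all_boot all_order all_algebra.
From mathcomp Require Import all_classical all_reals all_analysis.
Set Implicit Arguments. Unset Strict Implicit. Unset Printing Implicit Defensive.
Import Order.TTheory GRing.Theory Num.Theory.
Import numFieldNormedType.Exports.
Local Open Scope classical_set_scope.
Local Open Scope ring_scope.

Section Orlicz.
Context {R : realType} {d : measure_display} {T : measurableType d}.

(* Orlicz function on [0,oo) (values of Phi on negative reals are irrelevant),
   together with the standing assumptions Phi(t) > 0 for t > 0 and
   Phi(t)/t -> +oo. *)
Definition orlicz_function (Phi : R -> R) : Prop :=
  [/\ Phi 0 = 0,
      (forall s t : R, 0 <= s -> 0 <= t -> forall l : R, 0 <= l <= 1 ->
         Phi (l * s + (1 - l) * t) <= l * Phi s + (1 - l) * Phi t),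
      (forall s t : R, 0 <= s -> s <= t -> Phi s <= Phi t),
      (forall t : R, 0 < t -> 0 < Phi t) &
      (fun t => Phi t / t) @ +oo --> +oo].

Definition Delta2 (Phi : R -> R) : Prop :=
  exists t0 : R, 0 < t0 /\ exists k : R, forall t : R, t0 <= t -> Phi (2 * t) < k * Phi t.

Variable P : probability T R.

Definition nonatomic : Prop :=
  forall A : set T, measurable A -> (0 < P A)%E ->
    exists B : set T, [/\ measurable B, B `<=` A, (0 < P B)%E & (P B < P A)%E].

Variable Phi : R -> R.

Definition orlicz_modular (X : T -> R) (lambda : R) : \bar R :=
  (\int[P]_x (Phi (`|X x| / lambda))%:E)%E.

Definition in_LPhi (X : T -> R) : Prop :=
  measurable_fun setT X /\
  exists lambda : R, 0 < lambda /\ (orlicz_modular X lambda <= 1)%E.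

Definition orlicz_norm (X : T -> R) : R :=
  inf [set lambda : R | 0 < lambda /\ (orlicz_modular X lambda <= 1)%E].

(* Functionals rho : L^Phi -> (-oo, +oo]; only values on L^Phi matter. *)
Implicit Types rho : (T -> R) -> \bar R.

Definition no_minus_infty rho : Prop :=
  forall X, in_LPhi X -> rho X != -oo%E.

Definition proper_fun rho : Prop :=
  exists X, in_LPhi X /\ (rho X < +oo)%E.

Definition convex_fun rho : Prop :=
  forall X Y, in_LPhi X -> in_LPhi Y -> forall l : R, 0 <= l <= 1 ->
    (rho (fun x => (l * X x + (1 - l) * Y x)%R) <= l%:E * rho X + (1 - l)%R%:E * rho Y)%E.

Definition quasiconvex_fun rho : Prop :=
  forall c : \bar R, forall X Y, in_LPhi X -> in_LPhi Y ->
    (rho X <= c)%E -> (rho Y <= c)%E -> forall l : R, 0 <= l <= 1 ->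
    (rho (fun x => (l * X x + (1 - l) * Y x)%R) <= c)%E.

Definition same_law (X Y : T -> R) : Prop :=
  forall B : set R, measurable B -> P (X @^-1` B) = P (Y @^-1` B).

Definition law_invariant rho : Prop :=
  forall X Y, in_LPhi X -> in_LPhi Y -> same_law X Y -> rho X = rho Y.

Definition norm_lsc rho : Prop :=
  forall (Xn : nat -> T -> R) X, (forall n, in_LPhi (Xn n)) -> in_LPhi X ->
    (fun n => orlicz_norm (fun x => (Xn n x - X x)%R)) @ \oo --> 0 ->
    (rho X <= limn_einf (fun n => rho (Xn n)))%E.

Definition fatou_property rho : Prop :=
  forall (Xn : nat -> T -> R) X Y, (forall n, in_LPhi (Xn n)) -> in_LPhi X ->
    in_LPhi Y ->
    {ae P, forall x, (fun n => Xn n x) @ \oo --> X x} ->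
    (forall n, {ae P, forall x, `|Xn n x| <= Y x}) ->
    (rho X <= limn_einf (fun n => rho (Xn n)))%E.

End Orlicz.

(* Main.v *)
(* Under Delta2 every element of L^Phi has finite modular at every scale, so by
   dominated convergence a dominated a.s. convergent sequence converges in norm,
   and norm lower semicontinuity alone gives the Fatou property.

   Conversely, consider the convex indicator (0 inside, +oo outside) of the Orlicz
   heart H = {X | E[Phi(|X|/a)] < oo for all a > 0}.  It is law-invariant, convex
   and, H being norm closed, norm lower semicontinuous.  If X lies in L^Phi but not
   in H, its truncations lie in H, converge to X and are dominated by |X|, so the
   Fatou property fails.  When Delta2 fails, such an X is obtained from t_n with
   Phi(2 t_n) >= n 2^(n+1) Phi(t_n) and disjoint A_n with
   P(A_n) = 2^-(n+1) / Phi(t_n), by letting X be t_n on each A_n. *)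
Require Import Defs.
From HB Require Import structures.
From mathcomp Require Import all_boot all_order all_algebra.
From mathcomp Require Import all_classical all_reals all_analysis.
From mathcomp Require Import measurable_realfun lra.
Set Implicit Arguments. Unset Strict Implicit. Unset Printing Implicit Defensive.
Import Order.TTheory GRing.Theory Num.Theory.
Import numFieldNormedType.Exports.
Local Open Scope classical_set_scope.
Local Open Scope ring_scope.

Lemma exists_expr_half_lt (R : realType) (e : R) : 0 < e ->
  exists n, 2^-1 ^+ n < e.
Proof.
move=> e0.
have /cvgrPdist_lt/(_ _ e0)[N _ hN] : (fun n => 2^-1 ^+ n : R) @ \oo --> (0 : R).
  by apply: cvg_expr; rewrite ger0_norm; lra.
exists N; have := hN N (leqnn N).
by rewrite sub0r normrN ger0_norm// exprn_ge0.
Qed.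

(** * Subsets of prescribed measure in a nonatomic probability space *)

Section nonatomic_subsets.
Context (R : realType) (d : measure_display) (T : measurableType d).
Context (P : probability T R) (natP : nonatomic P).

Let p (A : set T) : R := fine (P A).

Let pE A : measurable A -> P A = (p A)%:E.
Proof. by move=> mA; rewrite fineK ?fin_num_measure. Qed.

Let p_ge0 A : 0 <= p A.
Proof. exact: fine_ge0. Qed.

Let p0 : p set0 = 0. Proof. by rewrite /p measure0. Qed.

Let p_le A B : measurable A -> measurable B -> A `<=` B -> p A <= p B.
Proof.
move=> mA mB AB; rewrite -lee_fin -!pE//.
by apply: le_measure => //; rewrite inE.
Qed.

Let pU A B : measurable A -> measurable B -> A `&` B = set0 ->
  p (A `|` B) = p A + p B.
Proof.
move=> mA mB AB; apply: EFin_inj; rewrite EFinD -!pE//; last exact: measurableU.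
exact: measureU.
Qed.

Let pD A B : measurable A -> measurable B -> B `<=` A -> p (A `\` B) = p A - p B.
Proof.
move=> mA mB BA; apply/eqP; rewrite eq_sym subr_eq; apply/eqP.
rewrite -pU//; last by rewrite setDE -setIA setICl setI0.
  by rewrite setDKU.
exact: measurableD.
Qed.

(** Nonatomicity splits a set of positive measure into two pieces of positive measure, one of which
    has at most half of the total; iterating this gives pieces of measure at most 2^-n. *)
Lemma nonatomic_small (A : set T) (e : R) : measurable A -> 0 < fine (P A) ->
  0 < e ->
  exists B : set T, [/\ measurable B, B `<=` A, 0 < fine (P B) & fine (P B) <= e].
Proof.
move=> mA A0 e0.
have half C : measurable C -> 0 < p C ->
    exists B, [/\ measurable B, B `<=` C, 0 < p B & p B <= 2^-1 * p C].
  move=> mC C0; have [|B [mB BC]] := @natP C mC; first by rewrite pE// lte_fin.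
  rewrite !pE// !lte_fin => B0 BltC.
  have [hB|hB] := leP (p B) (2^-1 * p C); first by exists B.
  exists (C `\` B); split; [exact: measurableD | exact: subDsetl | |];
    rewrite pD//; lra.
have [n hn] := exists_expr_half_lt e0.
have [B [mB BA B0 Bn]] : exists B, [/\ measurable B, B `<=` A, 0 < p B &
    p B <= 2^-1 ^+ n].
  elim: n {hn} => [|n [B [mB BA B0 Bn]]].
    exists A; split => //; rewrite expr0 -lee_fin -pE//; exact: probability_le1.
  have [C [mC CB C0 Cn]] := half B mB B0.
  exists C; split => //; first exact: subset_trans BA.
  by rewrite exprS (le_trans Cn)// ler_pM2l.
by exists B; split => //; rewrite (le_trans Bn)// ltW.
Qed.

(* Sierpinski's theorem, by exhaustion: each step adds a set whose measure is at
   least half of what can still be added without exceeding the target. *)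
Lemma nonatomic_exact (A : set T) (q : R) : measurable A ->
  0 <= q <= fine (P A) ->
  exists B : set T, [/\ measurable B, B `<=` A & fine (P B) = q].
Proof.
move=> mA /andP[q0 qA].
(* [adm S C]: [C] can still be added to [S] inside [A] without exceeding the target [q]. *)
pose adm S C := [/\ measurable C, C `<=` A `\` S & p C <= q - p S].
(* The conditions on [S] stand under the existential so that [choice] yields a function defined on
   all sets. *)
have step S : exists C, measurable S -> p S <= q ->
    adm S C /\ forall C', adm S C' -> p C' <= 2 * p C.
  have [[mS Sq]|nS] := pselect (measurable S /\ p S <= q); last first.
    by exists set0 => mS Sq; case: nS.
  have adm0 : adm S set0.
    by split => //; rewrite p0 subr_ge0.
  pose V := [set p C | C in adm S].
  have V0 : V !=set0 by exists (p set0); exists set0.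
  have ubV : has_ubound V by exists (q - p S) => _ [C [_ _ ?] <-].
  (* If the supremum is at most 0, all admissible sets are null and [set0] will do; otherwise some
     admissible set has more than half of it. *)
  have [s0|s0] := leP (sup V) 0.
    exists set0 => _ _; split => // C' admC'.
    have : p C' <= sup V by apply: ub_le_sup => //; exists C'.
    by rewrite p0 mulr0 => /le_trans; apply.
  have /sup_gt[//|_ [C admC <-] hC] : 2^-1 * sup V < sup V by lra.
  exists C => _ _; split => // C' admC'.
  have : p C' <= sup V by apply: ub_le_sup => //; exists C'.
  by move=> ?; lra.
have [f hf] := choice step.
pose S := fix S n := if n is m.+1 then S m `|` f (S m) else set0.
have hS n : [/\ measurable (S n), S n `<=` A & p (S n) <= q].
  elim: n => [|n [mS SA Sq]] /=; first by split => //; rewrite p0.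
  have [[mC CAS Cq] _] := hf _ mS Sq; split.
  - exact: measurableU.
  - by rewrite subUset; split => //; apply: subset_trans CAS _; apply: subDsetl.
  - rewrite pU//; first by move: Cq; lra.
    by apply/seteqP; split => // x [Sx /CAS[]].
have mS n : measurable (S n) by have [] := hS n.
have pS n : p (S n.+1) = p (S n) + p (f (S n)).
  have [mSn _ Sq] := hS n; have [[mC CAS _] _] := hf _ mSn Sq.
  by rewrite /= pU//; apply/seteqP; split => // x [Sx /CAS[]].
pose B := \bigcup_n S n.
have mB : measurable B by exact: bigcupT_measurable.
have BA : B `<=` A by move=> x [n _]; have [_ + _] := hS n; exact.
have ndS : nondecreasing_seq S.
  by apply/nondecreasing_seqP => n; apply/subsetPset => x; left.
have Bq : p B <= q.
  rewrite -lee_fin -pE//.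
  have := nondecreasing_cvg_mu mS mB ndS => /(_ _ P) cvgS.
  rewrite -(cvg_lim _ cvgS)//; apply: lime_le; first by apply/cvg_ex; exists (P B).
  by apply: nearW => n /=; rewrite pE// lee_fin; have [] := hS n.
exists B; split => //; apply/eqP; rewrite -/(p B) eq_le Bq/= leNgt; apply/negP => Bltq.
(* If [B] missed the target, a small set [C] of positive measure outside [B] would be admissible at
   every stage. Each stage would then add at least half of [p C], and the measures of the [S n]
   would be unbounded. *)
have [|//||C [mC CAB C0 Ce]] := @nonatomic_small (A `\` B) (q - p B).
- exact: measurableD.
- by rewrite -/(p _) pD// subr_gt0; exact: lt_le_trans Bltq qA.
- by rewrite subr_gt0.
have hC n : p C <= 2 * p (f (S n)).
  have [mSn _ Sq] := hS n; have [_ ] := hf _ mSn Sq; apply; split => //.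
    by apply: subset_trans CAB _ => x [Ax Bx]; split => // Sx; apply: Bx; exists n.
  have : p (S n) <= p B by apply: p_le => // x Sx; exists n.
  by move: Ce; rewrite -/(p C); lra.
have grow n : n%:R * p C <= 2 * p (S n).
  elim: n => [|n IHn]; first by rewrite mul0r mulr_ge0.
  by rewrite pS -natr1 mulrDl mul1r; have := hC n; lra.
have pC0 : 0 < p C by [].
have /archi_boundP : 0 <= 2 * q / p C by rewrite divr_ge0 ?mulr_ge0.
rewrite ltr_pdivrMr//; set N := Num.bound _ => qN.
by have [_ _] := hS N; have := grow N; lra.
Qed.

(** The sets are cut one after another from what remains. Before cut n the remainder has measure at
    least 2^-n, so a piece of measure at most 2^-(n+1) fits and leaves at least 2^-(n+1). *)
Lemma nonatomic_disjoint (q : R ^nat) : (forall n, 0 <= q n <= 2^-1 ^+ n.+1) ->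
  exists A : (set T) ^nat, [/\ forall n, measurable (A n), trivIset setT A &
    forall n, P (A n) = (q n)%:E].
Proof.
move=> hq.
have pick (Sr : set T * R) : exists B, measurable Sr.1 -> 0 <= Sr.2 <= p Sr.1 ->
    [/\ measurable B, B `<=` Sr.1 & p B = Sr.2].
  have [[mS hr]|nS] := pselect (measurable Sr.1 /\ 0 <= Sr.2 <= p Sr.1).
    by have [B ?] := nonatomic_exact mS hr; exists B.
  by exists set0 => ? ?; case: nS.
have [f hf] := choice pick.
pose S := fix S n := if n is m.+1 then S m `\` f (S m, q m) else setT.
have hS n : measurable (S n) /\ 2^-1 ^+ n <= p (S n).
  elim: n => [|n [mS Sn]] /=; first by rewrite expr0 /p probability_setT.
  have Sq : 0 <= q n <= p (S n).
    have /andP[-> /le_trans] /= := hq n; apply; rewrite (le_trans _ Sn)// exprS.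
    by rewrite ler_piMl ?exprn_ge0//; lra.
  have [mB BS pB] := hf (S n, q n) mS Sq; split; first exact: measurableD.
  rewrite pD// pB/=; have /andP[_] := hq n; rewrite exprS.
  by move: Sn; set u := 2^-1 ^+ n; lra.
have hA n : [/\ measurable (f (S n, q n)), f (S n, q n) `<=` S n &
    p (f (S n, q n)) = q n].
  have [mS Sn] := hS n; apply: hf => //=.
  have /andP[-> /le_trans] /= := hq n; apply; rewrite (le_trans _ Sn)// exprS.
  by rewrite ler_piMl ?exprn_ge0//; lra.
have decrS n m : (n <= m)%N -> S m `<=` S n.
  move=> /subnK <-; elim: (m - n)%N => //= k IHk x [Sx _]; exact: IHk.
exists (fun n => f (S n, q n)); split.
- by move=> n; have [] := hA n.
- apply/trivIsetP => i j _ _; wlog ij : i j / (i < j)%N.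
    move=> H; rewrite neq_ltn => /orP[ij|ji]; first by apply: H; rewrite ?neq_ltn ij.
    by rewrite setIC; apply: H => //; rewrite neq_ltn ji.
  move=> _; apply/seteqP; split => // x [fi fj].
  have [_ /(_ _ fj) Sj _] := hA j.
  have [_ nfi] : (S i `\` f (S i, q i)) x by exact: (decrS i.+1 j ij _ Sj).
  exact: nfi fi.
- by move=> n; have [mA _ pA] := hA n; rewrite pE// pA.
Qed.

End nonatomic_subsets.

(** * The Orlicz modular and the norm it defines *)

Lemma integral_prob_cst (R : realType) (d : measure_display)
  (T : measurableType d) (P : probability T R) (c : \bar R) :
  (\int[P]_x c = c)%E.
Proof. by rewrite -[RHS]mule1 -(@probability_setT _ _ _ P) -integral_cst. Qed.

Section orlicz.
Context (R : realType) (d : measure_display) (T : measurableType d).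
Context (P : probability T R) (Phi : R -> R) (hPhi : orlicz_function Phi).

Local Notation modular := (orlicz_modular P Phi).

Let Phi0 : Phi 0 = 0. Proof. by have [] := hPhi. Qed.

Let Phi_conv (s t l : R) : 0 <= s -> 0 <= t -> 0 <= l <= 1 ->
  Phi (l * s + (1 - l) * t) <= l * Phi s + (1 - l) * Phi t.
Proof. by have [_ + _ _ _] := hPhi => h s0 t0 l01; exact: h. Qed.

Let Phi_le (s t : R) : 0 <= s -> s <= t -> Phi s <= Phi t.
Proof. by have [_ _ + _ _] := hPhi; apply. Qed.

Lemma orlicz_function_ge0 (t : R) : 0 <= t -> 0 <= Phi t.
Proof. by move=> t0; rewrite -Phi0; exact: Phi_le. Qed.

Let Phi_abs_ge0 (x a : R) : 0 <= a -> (0 <= (Phi (`|x| / a))%:E)%E.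
Proof. by move=> a0; rewrite lee_fin orlicz_function_ge0// divr_ge0. Qed.

Let measurable_Phi_abs (a : R) : 0 <= a ->
  measurable_fun setT (fun y : R => (Phi (`|y| / a))%:E).
Proof.
move=> a0; apply/measurable_EFinP.
(* [Phi] is arbitrary on negative reals; composing with max(0, y) gives a nondecreasing, hence
   measurable, function on the whole line. *)
have -> : (fun y => Phi (`|y| / a)) =
    (fun y => Phi (Num.max 0 y)) \o (fun y : R => `|y| / a).
  by apply/funext => y /=; rewrite max_r// divr_ge0.
apply: measurableT_comp; last first.
  by apply: measurable_funM => //; exact: measurable_normr.
apply: nondecreasing_measurable => // s t st.
apply: Phi_le; first by rewrite le_max lexx.
by rewrite ge_max !le_max lexx st orbT.
Qed.

Lemma measurable_orlicz (X : T -> R) (a : R) : 0 <= a -> measurable_fun setT X ->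
  measurable_fun setT (fun x => (Phi (`|X x| / a))%:E).
Proof. by move=> a0 mX; exact: (measurableT_comp (measurable_Phi_abs a0)). Qed.

Lemma modular_ge0 (X : T -> R) (a : R) : 0 <= a -> (0 <= modular X a)%E.
Proof. by move=> a0; apply: integral_ge0 => x _; exact: Phi_abs_ge0. Qed.

Lemma le_modular (X Y : T -> R) (a b : R) : 0 <= a -> 0 <= b ->
  measurable_fun setT X -> measurable_fun setT Y ->
  (forall x, `|X x| / a <= `|Y x| / b) -> (modular X a <= modular Y b)%E.
Proof.
move=> a0 b0 mX mY XY; apply: ge0_le_integral => //.
- by move=> x _; exact: Phi_abs_ge0.
- exact: measurable_orlicz.
- exact: measurable_orlicz.
- by move=> x _; rewrite lee_fin; apply: Phi_le => //; rewrite divr_ge0.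
Qed.

Lemma modular_convex (X Y : T -> R) (a l : R) : 0 < a -> 0 <= l <= 1 ->
  measurable_fun setT X -> measurable_fun setT Y ->
  (modular (fun x => (l * X x + (1 - l) * Y x)%R) a <=
   l%:E * modular X a + (1 - l)%:E * modular Y a)%E.
Proof.
move=> a_gt0 l01 mX mY; have a0 := ltW a_gt0; have /andP[l0 l1] := l01.
have l1' : 0 <= 1 - l by rewrite subr_ge0.
rewrite -!ge0_integralZl_EFin//; try by
  [move=> x _; exact: Phi_abs_ge0|exact: measurable_orlicz].
have mZ c (Z : T -> R) : measurable_fun setT Z ->
    measurable_fun setT (fun x => (c%:E * (Phi (`|Z x| / a))%:E)%E).
  by move=> mZ; apply: measurable_funeM; exact: measurable_orlicz.
rewrite -ge0_integralD//; try by
  [move=> x _; rewrite mule_ge0// Phi_abs_ge0|exact: mZ].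
apply: ge0_le_integral => //.
- by move=> x _; exact: Phi_abs_ge0.
- by apply: measurable_orlicz => //; apply: measurable_funD; exact: measurable_funM.
- by apply: emeasurable_funD; exact: mZ.
- move=> x _; rewrite lee_fin; apply: le_trans (Phi_conv _ _ l01); last 2 first.
  + by rewrite divr_ge0.
  + by rewrite divr_ge0.
  + apply: Phi_le; first by rewrite divr_ge0.
    rewrite !mulrA -mulrDl ler_pM2r ?invr_gt0//.
    by rewrite (le_trans (ler_normD _ _))// !normrM (ger0_norm l0) (ger0_norm l1').
Qed.

(** (X - Y)/(2a) is the midpoint of X/a and -Y/a, so this is convexity at 1/2. It takes the place of
    a triangle inequality for the norm. *)
Lemma modularB (X Y : T -> R) (a : R) : 0 < a ->
  measurable_fun setT X -> measurable_fun setT Y ->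
  (modular (fun x => (X x - Y x)%R) (2 * a) <=
   2^-1%:E * (modular X a + modular Y a))%E.
Proof.
move=> a0 mX mY.
have mNY : measurable_fun setT (\- Y) by exact: measurable_funN.
have h : 0 <= (2^-1 : R) <= 1 by lra.
have := modular_convex a0 h mX mNY.
have -> : 1 - 2^-1 = 2^-1 :> R by lra.
have -> : modular (\- Y) a = modular Y a.
  by apply: eq_integral => x _; rewrite normrN.
rewrite -ge0_muleDr; [|exact: modular_ge0 (ltW a0)..].
move=> le_half; apply: le_trans le_half.
apply: le_modular => //.
- by rewrite mulr_ge0// ltW.
- exact: ltW.
- exact: measurable_funB.
- by apply: measurable_funD; exact: measurable_funM.
- move=> x; rewrite -mulrDr normrM ger0_norm// invfM mulrA.
  by rewrite [2^-1 * _]mulrC.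
Qed.

Lemma in_LPhiB (X Y : T -> R) : in_LPhi P Phi X -> in_LPhi P Phi Y ->
  in_LPhi P Phi (fun x => X x - Y x).
Proof.
move=> [mX [a [a0 Xa]]] [mY [b [b0 Yb]]]; split; first exact: measurable_funB.
have ab0 : 0 < a + b by rewrite addr_gt0.
(* At scale a + b both modulars are at most 1, since the scale exceeds [a] and [b]; the factor 2
   comes from [modularB]. *)
exists (2 * (a + b)); split; first by rewrite mulr_gt0.
apply: le_trans (modularB ab0 mX mY) _.
have Xab : (modular X (a + b) <= 1)%E.
  apply: le_trans Xa; apply: le_modular => //; rewrite ?ltW// => x.
  by rewrite ler_wpM2l// lef_pV2 ?posrE// lerDl ltW.
have Yab : (modular Y (a + b) <= 1)%E.
  apply: le_trans Yb; apply: le_modular => //; rewrite ?ltW// => x.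
  by rewrite ler_wpM2l// lef_pV2 ?posrE// lerDr ltW.
apply: (@le_trans _ _ (2^-1%:E * (1 + 1))%E).
  by rewrite lee_pmul2l//; exact: leeD.
by rewrite -EFinD -EFinM lee_fin; lra.
Qed.

Lemma le_in_LPhi (X Y : T -> R) : measurable_fun setT X -> in_LPhi P Phi Y ->
  (forall x, `|X x| <= `|Y x|) -> in_LPhi P Phi X.
Proof.
move=> mX [mY [a [a0 Ya]]] XY; split => //; exists a; split => //.
apply: le_trans Ya; apply: le_modular => //; rewrite ?ltW// => x.
by rewrite ler_wpM2r// invr_ge0 ltW.
Qed.

(** By change of variables the modular is an integral against the pushforward of [P], which is the
    law. *)
Lemma modular_same_law (X Y : T -> R) (a : R) : 0 <= a ->
  measurable_fun setT X -> measurable_fun setT Y -> same_law P X Y ->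
  modular X a = modular Y a.
Proof.
move=> a0 mX mY XY; pose g (y : R) := (Phi (`|y| / a))%:E.
have push Z : measurable_fun setT Z ->
    modular Z a = (\int[pushforward P Z]_y g y)%E.
  move=> mZ; rewrite ge0_integral_pushforward//; first exact: measurable_Phi_abs.
  by move=> y _; exact: Phi_abs_ge0.
rewrite !push//.
pose mXX := HB.pack_for {mfun T >-> R} X (isMeasurableFun.Build _ _ _ _ X mX).
pose mYY := HB.pack_for {mfun T >-> R} Y (isMeasurableFun.Build _ _ _ _ Y mY).
have := @eq_measure_integral _ _ R setT (pushforward P mYY) (pushforward P mXX) g.
by apply => A mA _; exact: XY.
Qed.

Lemma orlicz_norm_ge0 (X : T -> R) : 0 <= orlicz_norm P Phi X.
Proof.
rewrite /orlicz_norm; set S := [set l | _].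
(* Outside L^Phi the set of scales may be empty; its infimum is then 0 by convention. *)
have [->|S0] := eqVneq S set0; first by rewrite inf0.
by apply: lb_le_inf; [exact/set0P | move=> a [/ltW]].
Qed.

Lemma orlicz_norm_le (X : T -> R) (a : R) : 0 < a -> (modular X a <= 1)%E ->
  orlicz_norm P Phi X <= a.
Proof. by move=> a0 Xa; apply: ge_inf => //; exists 0 => b [/ltW]. Qed.

Lemma modular_orlicz_norm_lt (X : T -> R) (a : R) : in_LPhi P Phi X ->
  orlicz_norm P Phi X < a -> (modular X a <= 1)%E.
Proof.
move=> [mX [b hb]] Xa.
have [|c [c0 Xc] ca] := inf_lt _ Xa; first by exists b.
have a0 := lt_trans c0 ca; apply: le_trans Xc.
apply: le_modular; rewrite ?ltW// => x.
by rewrite ler_wpM2l// lef_pV2 ?posrE// ltW.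
Qed.

Lemma orlicz_norm_cvg0 (Z : (T -> R) ^nat) :
  (forall a, 0 < a -> \forall n \near \oo, (modular (Z n) a <= 1)%E) ->
  (fun n => orlicz_norm P Phi (Z n)) @ \oo --> 0.
Proof.
move=> h; apply/cvgrPdist_le => e e0; near=> n.
rewrite sub0r normrN ger0_norm ?orlicz_norm_ge0// orlicz_norm_le//.
by near: n; exact: h.
Unshelve. all: by end_near. Qed.

(** * The Orlicz heart: convexity, closedness, and the effect of [Delta2] *)

Definition orlicz_heart (X : T -> R) := forall a, 0 < a -> (modular X a < +oo)%E.

Lemma bounded_orlicz_heart (X : T -> R) (M : R) : measurable_fun setT X ->
  (forall x, `|X x| <= M) -> orlicz_heart X.
Proof.
move=> mX XM a a0.
apply: (@le_lt_trans _ _ (modular (cst M) a)); last first.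
  by rewrite [modular _ _](integral_prob_cst P (Phi (`|M| / a))%:E) ltry.
apply: le_modular; rewrite ?ltW// => x.
apply: ler_wpM2r; first by rewrite invr_ge0 ltW.
exact: le_trans (XM x) (ler_norm M).
Qed.

Lemma orlicz_heart_convex (X Y : T -> R) (l : R) : in_LPhi P Phi X ->
  in_LPhi P Phi Y -> orlicz_heart X -> orlicz_heart Y -> 0 <= l <= 1 ->
  orlicz_heart (fun x => l * X x + (1 - l) * Y x).
Proof.
move=> [mX _] [mY _] hX hY l01 a a0.
apply: le_lt_trans (modular_convex a0 l01 mX mY) _; have /andP[l0 l1] := l01.
have fin Z c : orlicz_heart Z -> (c%:E * modular Z a)%E \is a fin_num.
  by move=> hZ; rewrite fin_numM// ge0_fin_numE ?modular_ge0 ?ltW// hZ.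
by rewrite ltey_eq fin_numD !fin.
Qed.

(** Take a scale [a] at which [X] has infinite modular. Once the norm of Xn - X is below a/2, its
    modular at a/2 is at most 1; if Xn were in the heart, [modularB] applied to X = Xn - (Xn - X)
    would make the modular of [X] at [a] finite. The contrapositive form is what lower
    semicontinuity of the indicator calls for. *)
Lemma orlicz_heart_closed (Xn : (T -> R) ^nat) X :
  (forall n, in_LPhi P Phi (Xn n)) -> in_LPhi P Phi X ->
  (fun n => orlicz_norm P Phi (fun x => Xn n x - X x)) @ \oo --> 0 ->
  ~ orlicz_heart X -> \forall n \near \oo, ~ orlicz_heart (Xn n).
Proof.
move=> hXn hX cvgX /existsNP[a /not_implyP[a0 Xa]].
have a20 : 0 < a / 2 by rewrite divr_gt0.
have /cvgrPdist_lt/(_ _ a20) near0 := cvgX.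
near=> n => heart; apply: Xa.
have nX : orlicz_norm P Phi (fun x => Xn n x - X x) < a / 2.
  have : `|0 - orlicz_norm P Phi (fun x => Xn n x - X x)| < a / 2 by near: n.
  by rewrite sub0r normrN ger0_norm// orlicz_norm_ge0.
have hD := in_LPhiB (hXn n) hX; have := modular_orlicz_norm_lt hD nX => D1.
have [mXn _] := hXn n; have [mX _] := hX; have [mD _] := hD.
have -> : X = (fun x => Xn n x - (Xn n x - X x)).
  by apply/funext => x; rewrite opprB addrCA subrr addr0.
have -> : a = 2 * (a / 2) by rewrite mulrCA divff ?mulr1.
apply: le_lt_trans (modularB a20 mXn mD) _.
rewrite lte_mul_pinfty// lte_add_pinfty ?heart//.
exact: le_lt_trans D1 (ltry 1).
Unshelve. all: by end_near. Qed.

(** Under [Delta2], halving the scale keeps the modular finite; halving repeatedly from one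
    admissible scale gets below any positive [a]. *)
Lemma Delta2_orlicz_heart (X : T -> R) : Delta2 Phi -> in_LPhi P Phi X ->
  orlicz_heart X.
Proof.
move=> [t0 [t00 [k hk]]] [mX [b [b0 Xb]]].
(* A negative [k] would give Phi(2 t0) < k Phi(t0) <= 0. *)
have k0 : 0 <= k.
  rewrite leNgt; apply/negP => k0; have := hk t0 (lexx _); apply/negP.
  rewrite -leNgt (@le_trans _ _ 0)//.
    by rewrite nmulr_rle0// orlicz_function_ge0// ltW.
  by rewrite orlicz_function_ge0// mulr_ge0// ltW.
(* The additive constant covers t < t0 by monotonicity, and it is integrable because [P] is
   finite. *)
have Phi2_le t : 0 <= t -> Phi (2 * t) <= Phi (2 * t0) + k * Phi t.
  move=> t_ge0; have [/hk/ltW h|/ltW tt0] := leP t0 t.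
    by rewrite (le_trans h)// lerDr orlicz_function_ge0// mulr_ge0// ltW.
  rewrite ler_wpDr ?mulr_ge0 ?orlicz_function_ge0//.
  by apply: Phi_le; rewrite ?mulr_ge0// ler_pM2l.
have half a : 0 < a -> (modular X a < +oo)%E -> (modular X (a / 2) < +oo)%E.
  move=> a_gt0 Xa; have a0 := ltW a_gt0.
  have Phi2t0 : 0 <= Phi (2 * t0) by rewrite orlicz_function_ge0// mulr_ge0// ltW.
  apply: (@le_lt_trans _ _
      (\int[P]_x ((Phi (2 * t0))%:E + k%:E * (Phi (`|X x| / a))%:E))%E).
    apply: ge0_le_integral => //.
    - by move=> x _; rewrite Phi_abs_ge0// divr_ge0.
    - by apply: measurable_orlicz => //; rewrite divr_ge0.
    - apply: emeasurable_funD => //; apply: measurable_funeM.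
      exact: measurable_orlicz.
    - move=> x _; rewrite -EFinM -EFinD lee_fin invf_div mulrCA.
      by apply: Phi2_le; rewrite divr_ge0.
  rewrite ge0_integralD//=; last 2 first.
  - by move=> x _; rewrite mule_ge0// Phi_abs_ge0.
  - by apply: measurable_funeM; exact: measurable_orlicz.
  rewrite ge0_integralZl_EFin//; last 2 first.
  - by move=> x _; exact: Phi_abs_ge0.
  - exact: measurable_orlicz.
  by rewrite integral_prob_cst lte_add_pinfty ?ltry// lte_mul_pinfty.
have halves n : (modular X (b * 2^-1 ^+ n) < +oo)%E.
  elim: n => [|n IHn]; first by rewrite expr0 mulr1 (le_lt_trans Xb)// ltry.
  by rewrite exprSr mulrA; apply: half => //; rewrite mulr_gt0// exprn_gt0.
move=> a a0; have [n hn] := exists_expr_half_lt (divr_gt0 a0 b0).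
apply: le_lt_trans (halves n); apply: le_modular; rewrite ?ltW//.
  by rewrite mulr_gt0// exprn_gt0.
move=> x; rewrite ler_wpM2l// lef_pV2 ?posrE ?mulr_gt0 ?exprn_gt0//.
by move: hn; rewrite ltr_pdivlMr// mulrC => /ltW.
Qed.

(** * Dominated convergence in the Orlicz norm *)

Lemma orlicz_function_cvg0 (u : R ^nat) : (forall n, 0 <= u n) ->
  u @ \oo --> 0 -> (fun n => Phi (u n)) @ \oo --> 0.
Proof.
move=> u0 ucvg.
have Phi1 : 0 < Phi 1 by have [_ _ _ + _] := hPhi; apply.
apply/cvgrPdist_le => e e0.
(* For u in [0,1], convexity between 0 and 1 gives Phi(u) <= u Phi(1), which is at most [e] once u
   <= e / Phi(1). *)
have m0 : 0 < Num.min 1 (e / Phi 1) by rewrite lt_min ltr01 divr_gt0.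
have /cvgrPdist_le/(_ _ m0) near0 := ucvg.
near=> n.
have : `|0 - u n| <= Num.min 1 (e / Phi 1) by near: n.
rewrite !sub0r !normrN !ger0_norm ?orlicz_function_ge0// le_min => /andP[u1 ue].
have u01 : 0 <= u n <= 1 by rewrite u0.
have := Phi_conv ler01 (lexx 0) u01.
rewrite mulr1 !mulr0 Phi0 mulr0 !addr0 => /le_trans; apply.
by rewrite -ler_pdivlMr.
Unshelve. all: by end_near. Qed.

(** Almost surely |Xn - X| <= 2Y, so at scale [a] the integrands are dominated by Phi(|Y| / (a/2)),
    integrable because [Y] is in the heart. The modulars therefore tend to 0 at every scale, and in
    particular are eventually at most 1. *)
Lemma dominated_cvg_orlicz_norm (Xn : (T -> R) ^nat) (X Y : T -> R) :
  (forall n, in_LPhi P Phi (Xn n)) -> in_LPhi P Phi X -> orlicz_heart Y ->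
  measurable_fun setT Y ->
  {ae P, forall x, (fun n => Xn n x) @ \oo --> X x} ->
  (forall n, {ae P, forall x, `|Xn n x| <= Y x}) ->
  (fun n => orlicz_norm P Phi (fun x => Xn n x - X x)) @ \oo --> 0.
Proof.
move=> hXn hX hY mY XnX XnY; apply: orlicz_norm_cvg0 => a a_gt0.
have a0 := ltW a_gt0; have a20 : 0 < a / 2 by rewrite divr_gt0.
have mD n : measurable_fun setT (fun x => Xn n x - X x).
  by apply: measurable_funB; [have [] := hXn n | have [] := hX].
have /ae_foralln {}XnY := XnY.
have [|||||_ _] := @dominated_convergence _ _ R P setT measurableT
  (fun n x => (Phi (`|Xn n x - X x| / a))%:E) (cst 0)
  (fun x => (Phi (`|Y x| / (a / 2)))%:E).
- by move=> n; exact: measurable_orlicz.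
- exact: measurable_cst.
- near=> x => _; apply/fine_cvgP; split; first exact: nearW.
  apply: orlicz_function_cvg0 => [n|]; first by rewrite divr_ge0.
  have cX : (fun n => Xn n x) @ \oo --> X x by near: x.
  rewrite -(mul0r a^-1) -(@normr0 _ R) -(subrr (X x)).
  by apply: cvgM; [apply: cvg_norm; apply: cvgB => //|]; exact: cvg_cst.
- apply/integrableP; split; first by apply: measurable_orlicz => //; exact: ltW.
  under eq_integral do rewrite gee0_abs ?Phi_abs_ge0 ?(ltW a20)//.
  exact: hY.
- near=> x => n _.
  have cX : (fun n => Xn n x) @ \oo --> X x by near: x.
  have XY m : `|Xn m x| <= Y x by move: m; near: x.
  have XxY : `|X x| <= Y x.
    rewrite -(cvg_lim _ (cvg_norm cX))//; apply: limr_le.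
      by apply/cvg_ex; exists `|X x|; exact: cvg_norm.
    exact: nearW.
  rewrite gee0_abs ?Phi_abs_ge0// lee_fin; apply: Phi_le; first by rewrite divr_ge0.
  rewrite invf_div mulrA ler_pM2r ?invr_gt0// (le_trans (ler_normB _ _))//.
  by have := XY n; have := ler_norm (Y x); lra.
- rewrite integral0 => /fine_cvgP[fin0 cvg0].
  near=> n; have hfin : modular (fun x => Xn n x - X x) a \is a fin_num by near: n.
  by rewrite -(fineK hfin) lee_fin; near: n; exact: (cvgr_le _ cvg0 1 ltr01).
Unshelve. all: by end_near. Qed.

End orlicz.

(** * An element of L^Phi outside the heart when [Delta2] fails *)

Section disjoint_simple_series.
Context (R : realType) (T : Type) (A : (set T) ^nat) (c : R ^nat).
Context (c0 : forall n, 0 <= c n) (tA : trivIset setT A).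

Lemma disjoint_series_in n x : A n x ->
  (\sum_(k <oo) (c k * \1_(A k) x)%:E = (c n)%:E)%E.
Proof.
move=> Anx; rewrite (nneseriesD1 (n := n))//; last first.
  by move=> k _; rewrite lee_fin mulr_ge0.
rewrite indicE mem_set// mulr1 eseries0 ?adde0// => k _ /= kn.
rewrite indicE memNset ?mulr0// => Akx.
by move: kn; rewrite (tA I I (ex_intro _ x (conj Akx Anx))) eqxx.
Qed.

Lemma disjoint_series_notin x : (forall n, ~ A n x) ->
  (\sum_(k <oo) (c k * \1_(A k) x)%:E = 0)%E.
Proof. by move=> Ax; apply: eseries0 => k _ _; rewrite indicE memNset ?mulr0. Qed.

End disjoint_simple_series.

(** Superlinear growth gives a [t0] beyond which Phi >= 1. If no [t] worked for some [n], then [t0]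
    and [k n] would witness [Delta2]. *)
Lemma not_Delta2_seq (R : realType) (Phi : R -> R) : orlicz_function Phi ->
  ~ Delta2 Phi -> forall k : R ^nat, exists t : R ^nat, forall n,
    [/\ 0 < t n, 1 <= Phi (t n) & k n * Phi (t n) <= Phi (2 * t n)].
Proof.
move=> hPhi nD k; have [_ _ _ _ Phioo] := hPhi.
have [t0 t01 ht0] : exists2 t0 : R, 1 <= t0 & forall t, t0 <= t -> 1 <= Phi t.
  have /cvgryPge/(_ 1) [M [_ hM]] := Phioo.
  exists (Num.max 1 (M + 1)); first by rewrite le_max lexx.
  move=> t; rewrite ge_max => /andP[t1 Mt]; have t_gt0 : 0 < t by lra.
  have : 1 <= Phi t / t by apply: hM; lra.
  by rewrite ler_pdivlMr// mul1r; exact: le_trans.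
have ht n : exists t, [/\ 0 < t, 1 <= Phi t & k n * Phi t <= Phi (2 * t)].
  apply: contrapT => /forallNP ht; apply: nD; exists t0; split; first by lra.
  exists (k n) => t t0t; rewrite ltNge; apply/negP => hk; apply: (ht t); split => //.
    by lra.
  exact: ht0.
by have [t ?] := choice ht; exists t.
Qed.

Lemma sum_expr_half_le1 (R : realType) n :
  \sum_(0 <= k < n) 2^-1 ^+ k.+1 <= 1 :> R.
Proof.
suff -> : \sum_(0 <= k < n) 2^-1 ^+ k.+1 = 1 - 2^-1 ^+ n :> R.
  by rewrite lerBlDr lerDl exprn_ge0.
elim: n => [|n IHn]; first by rewrite big_nil expr0 subrr.
by rewrite big_nat_recr//= IHn exprS; lra.
Qed.

(** At scale 1 the set [A n] contributes 2^-(n+1) to the modular, for a total of at most 1; at scale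
    1/2 it alone contributes at least n. *)
Lemma exists_not_orlicz_heart (R : realType) (d : measure_display)
  (T : measurableType d) (P : probability T R) (Phi : R -> R) :
  nonatomic P -> orlicz_function Phi -> ~ Delta2 Phi ->
  exists X : T -> R, in_LPhi P Phi X /\ ~ orlicz_heart P Phi X.
Proof.
move=> natP hPhi nD.
have [t ht] := not_Delta2_seq hPhi nD (fun n => n%:R * 2 ^+ n.+1).
have t_gt0 n : 0 < t n by have [] := ht n.
have t0 n : 0 <= t n by exact: ltW.
have Phit1 n : 1 <= Phi (t n) by have [] := ht n.
have Phit_gt0 n : 0 < Phi (t n) by exact: lt_le_trans (Phit1 n).
have Phit0 n : 0 <= Phi (t n) by exact: ltW.
(* Since Phi(t n) >= 1, these measures respect the bound 2^-(n+1). *)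
have [|A [mA tA PA]] := @nonatomic_disjoint _ _ _ _ natP
    (fun n => 2^-1 ^+ n.+1 / Phi (t n)).
  by move=> n; rewrite divr_ge0//= ler_pdivrMr// ler_peMr.
(* Writing [X] as a series yields its measurability from that of the terms; by disjointness at most
   one term is nonzero at each point, so [fine] loses nothing. *)
pose X x := fine (\sum_(k <oo) (t k * \1_(A k) x)%:E)%E.
have mterm c n : measurable_fun setT (fun x => (c n * \1_(A n) x : R)%:E).
  by apply/measurable_EFinP; apply: measurable_funM => //; exact: measurable_indic.
have mX : measurable_fun setT X.
  apply: (measurableT_comp (fine_measurable measurableT)).
  apply: ge0_emeasurable_sum => [k x _ _|k _]; last exact: mterm.
  by rewrite lee_fin mulr_ge0.
have X_in n x : A n x -> X x = t n.
  by move=> Anx; rewrite /X (disjoint_series_in t0 tA Anx).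
have PhiX x : (Phi (`|X x| / 1))%:E = (\sum_(k <oo) (Phi (t k) * \1_(A k) x)%:E)%E.
  have [[n Anx]|nA] := pselect (exists n, A n x).
    by rewrite (X_in n)// (disjoint_series_in Phit0 tA Anx) divr1 gtr0_norm.
  have {}nA n : ~ A n x by move=> Anx; apply: nA; exists n.
  rewrite /X !disjoint_series_notin// normr0 mul0r.
  by have [-> _ _ _ _] := hPhi.
have int_term c n : 0 <= c ->
    (\int[P]_x (c * \1_(A n) x)%:E = (c * (2^-1 ^+ n.+1 / Phi (t n)))%:E)%E.
  move=> c0; under eq_integral do rewrite EFinM.
  rewrite ge0_integralZl_EFin//; last first.
    by apply/measurable_EFinP; exact: measurable_indic.
  by rewrite EFinM; congr (_ * _)%E; rewrite integral_indic// setIT; exact: PA.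
exists X; split.
  split => //; exists 1; split => //.
  rewrite /orlicz_modular; under eq_integral do rewrite PhiX.
  rewrite integral_nneseries//; [|exact: (mterm (Phi \o t))|]; last first.
    by move=> n x _; rewrite lee_fin mulr_ge0.
  apply: lime_le.
    apply: is_cvg_nneseries => n _ _; apply: integral_ge0 => x _.
    by rewrite lee_fin mulr_ge0.
  apply: nearW => n.
  under eq_bigr do rewrite int_term// mulrCA divff ?gt_eqF// mulr1.
  by rewrite sumEFin lee_fin sum_expr_half_le1.
move=> /(_ 2^-1) heart.
have /fineK : orlicz_modular P Phi X 2^-1 \is a fin_num.
  by rewrite ge0_fin_numE ?heart// modular_ge0// invr_ge0.
set M := fine _ => XM.
have nM n : n%:R <= M.
  rewrite -lee_fin XM; apply: (@le_trans _ _
    (\int[P]_x (Phi (2 * t n) * \1_(A n) x)%:E)%E).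
    have Phi2t0 : 0 <= Phi (2 * t n).
      by apply: (orlicz_function_ge0 hPhi); rewrite mulr_ge0.
    rewrite int_term// lee_fin mulrA ler_pdivlMr//.
    by rewrite exprVn ler_pdivlMr ?exprn_gt0// mulrAC; have [] := ht n.
  apply: ge0_le_integral => //.
  - move=> x _; rewrite lee_fin mulr_ge0// orlicz_function_ge0//.
    by rewrite mulr_ge0.
  - exact: (mterm (fun n => Phi (2 * t n))).
  - by apply: measurable_orlicz => //; rewrite invr_ge0.
  - move=> x _; rewrite lee_fin; have [Anx|nAx] := pselect (A n x).
      by rewrite indicE mem_set// mulr1 (X_in n)// gtr0_norm// invrK mulrC.
    rewrite indicE memNset// mulr0; apply: (orlicz_function_ge0 hPhi).
    by rewrite divr_ge0 ?invr_ge0.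
(* The finite modular [M] at scale 1/2 would bound every natural number; the case n = 0 supplies the
   M >= 0 that [archi_boundP] requires. *)
have := nM (Num.bound M).
by rewrite leNgt archi_boundP// (le_trans _ (nM 0%N)).
Qed.

(** * The convex indicator of the heart *)

Lemma limn_einf_ge (R : realType) (u : (\bar R) ^nat) (a : \bar R) :
  (forall n, (a <= u n)%E) -> (a <= limn_einf u)%E.
Proof.
move=> au; rewrite limn_einf_lim; apply: lime_ge; first exact: is_cvg_einfs.
by apply: nearW => n; apply/ereal_infP => _ [k _ <-].
Qed.

Section heart_indicator.
Context (R : realType) (d : measure_display) (T : measurableType d).
Context (P : probability T R) (Phi : R -> R) (hPhi : orlicz_function Phi).

Definition heart_indicator (X : T -> R) : \bar R :=
  if pselect (orlicz_heart P Phi X) then 0%E else +oo%E.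

Lemma heart_indicator_in X : orlicz_heart P Phi X -> heart_indicator X = 0%E.
Proof. by rewrite /heart_indicator; case: pselect. Qed.

Lemma heart_indicator_notin X : ~ orlicz_heart P Phi X ->
  heart_indicator X = +oo%E.
Proof. by rewrite /heart_indicator; case: pselect. Qed.

Let heart_indicator_ge0 X : (0 <= heart_indicator X)%E.
Proof. by rewrite /heart_indicator; case: pselect. Qed.

Lemma heart_indicator_no_minus_infty : no_minus_infty P Phi heart_indicator.
Proof. by move=> X _; rewrite gt_eqF// (lt_le_trans _ (heart_indicator_ge0 X)). Qed.

Lemma heart_indicator_proper : proper_fun P Phi heart_indicator.
Proof.
have heart0 : orlicz_heart P Phi (cst 0 : T -> R).
  by apply: (@bounded_orlicz_heart _ _ _ _ _ hPhi _ 0) => // x; rewrite normr0.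
exists (cst 0); split; last by rewrite heart_indicator_in.
split => //; exists 1; split => //.
rewrite /orlicz_modular; under eq_integral do rewrite normr0 mul0r.
by have [-> _ _ _ _] := hPhi; rewrite integral0.
Qed.

Lemma heart_indicator_convex : convex_fun P Phi heart_indicator.
Proof.
move=> X Y LX LY l l01; have /andP[l0 l1] := l01.
(* The endpoints are separate because 0 * +oo = 0; for 0 < l < 1 a value +oo at [X] or [Y] makes the
   right-hand side +oo. *)
have [->|l_neq0] := eqVneq l 0.
  rewrite mul0e add0e subr0 mul1e.
  by under eq_fun do rewrite mul0r add0r mul1r.
have [->|l_neq1] := eqVneq l 1.
  rewrite subrr mul0e adde0 mul1e.
  by under eq_fun do rewrite mul0r addr0 mul1r.
have lgt0 : 0 < l by rewrite lt_neqAle eq_sym l_neq0.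
have l1gt0 : 0 < 1 - l by rewrite subr_gt0 lt_neqAle l_neq1.
have [hX|hX] := pselect (orlicz_heart P Phi X); last first.
  rewrite (heart_indicator_notin hX) gt0_muley ?lte_fin// addye ?leey//.
  by rewrite gt_eqF// (lt_le_trans (ltNyr 0))// mule_ge0// lee_fin ltW.
have [hY|hY] := pselect (orlicz_heart P Phi Y); last first.
  rewrite (heart_indicator_notin hY) gt0_muley ?lte_fin// addey ?leey//.
  by rewrite gt_eqF// (lt_le_trans (ltNyr 0))// mule_ge0// lee_fin ltW.
by rewrite !heart_indicator_in// ?mule0 ?adde0//; exact: orlicz_heart_convex.
Qed.

Lemma heart_indicator_law_invariant : law_invariant P Phi heart_indicator.
Proof.
have same X Y : in_LPhi P Phi X -> in_LPhi P Phi Y -> same_law P X Y ->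
    orlicz_heart P Phi X -> orlicz_heart P Phi Y.
  move=> [mX _] [mY _] XY hX a a0.
  by rewrite -(modular_same_law hPhi (ltW a0) mX mY XY); exact: hX.
move=> X Y LX LY XY; have [hX|hX] := pselect (orlicz_heart P Phi X).
  by rewrite !heart_indicator_in//; exact: same hX.
rewrite !heart_indicator_notin// => hY; apply: hX; apply: same hY => //.
by move=> B mB; rewrite XY.
Qed.

(** In the heart the value 0 is the minimum; outside it, closedness makes the values along the
    sequence eventually +oo. *)
Lemma heart_indicator_norm_lsc : norm_lsc P Phi heart_indicator.
Proof.
move=> Xn X LXn LX XnX; have [hX|hX] := pselect (orlicz_heart P Phi X).
  by rewrite heart_indicator_in// limn_einf_ge.
have ev := orlicz_heart_closed hPhi LXn LX XnX hX.
have /cvg_limn_einf_sup[-> _] : heart_indicator (Xn n) @[n --> \oo] --> +oo%E.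
  by apply: cvg_near_cst; near=> n; apply: heart_indicator_notin; near: n.
exact: leey.
Unshelve. all: by end_near. Qed.

Lemma heart_indicator_not_fatou (X : T -> R) : in_LPhi P Phi X ->
  ~ orlicz_heart P Phi X -> ~ fatou_property P Phi heart_indicator.
Proof.
move=> LX hX fatou; have [mX _] := LX.
(* Each [Xn n] is bounded by n, hence in the heart, and at each point the sequence eventually equals
   [X]. *)
pose Xn (n : nat) x := if `|X x| <= n%:R then X x else 0.
have mXn n : measurable_fun setT (Xn n).
  apply: measurable_fun_ifT => //.
  by apply: measurable_fun_ler => //; exact: measurableT_comp.
have XnX n x : `|Xn n x| <= `|X x| by rewrite /Xn; case: ifP; rewrite ?normr0.
have LXn n : in_LPhi P Phi (Xn n) by exact: (le_in_LPhi hPhi (mXn n) LX).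
have LabsX : in_LPhi P Phi (fun x => `|X x|).
  by apply: (le_in_LPhi hPhi _ LX); [exact: measurableT_comp | move=> x; rewrite normr_id].
have hXn n : orlicz_heart P Phi (Xn n).
  apply: (@bounded_orlicz_heart _ _ _ _ _ hPhi _ n%:R (mXn n)) => x.
  by rewrite /Xn; case: ifP => // _; rewrite normr0.
have : (heart_indicator X <= limn_einf (fun n => heart_indicator (Xn n)))%E.
  apply: (fatou Xn X _ LXn LX LabsX) => [|n]; apply: aeW => x //.
  apply: cvg_near_cst; near=> n; rewrite /Xn ifT//.
  by near: n; exact: nbhs_infty_ger.
rewrite heart_indicator_notin//.
have /cvg_limn_einf_sup[-> _] : heart_indicator (Xn n) @[n --> \oo] --> 0%E.
  by apply: cvg_near_cst; apply: nearW => n; exact: heart_indicator_in.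
by [].
Unshelve. all: by end_near. Qed.

End heart_indicator.

(** * The two equivalences *)

Lemma norm_lsc_fatou (R : realType) (d : measure_display) (T : measurableType d)
  (P : probability T R) (Phi : R -> R) (rho : (T -> R) -> \bar R) :
  orlicz_function Phi -> Delta2 Phi -> norm_lsc P Phi rho ->
  fatou_property P Phi rho.
Proof.
move=> hPhi D2 lsc Xn X Y LXn LX LY XnX XnY; apply: lsc => //.
have [mY _] := LY; apply: (dominated_cvg_orlicz_norm hPhi LXn LX _ mY XnX XnY).
exact: Delta2_orlicz_heart.
Qed.

Lemma convex_quasiconvex (R : realType) (d : measure_display)
  (T : measurableType d) (P : probability T R) (Phi : R -> R)
  (rho : (T -> R) -> \bar R) :
  no_minus_infty P Phi rho -> convex_fun P Phi rho -> quasiconvex_fun P Phi rho.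
Proof.
move=> nminf cvx c X Y LX LY Xc Yc l l01; have /andP[l0 l1] := l01.
apply: le_trans (cvx _ _ LX LY _ l01) _.
(* The level +oo is trivial, and the level -oo is excluded by [no_minus_infty]. *)
have := nminf _ LX; case: c Xc Yc => [c| |] Xc Yc; rewrite ?leey//; last first.
  by move: Xc; rewrite leeNy_eq => ->.
move=> _; apply: (@le_trans _ _ (l%:E * c%:E + (1 - l)%:E * c%:E)%E).
  by apply: leeD; apply: lee_wpmul2l; rewrite // lee_fin// subr_ge0.
by rewrite -!EFinM -EFinD lee_fin -mulrDl addrCA subrr addr0 mul1r.
Qed.

Theorem theorem2 (R : realType) (d : measure_display) (T : measurableType d)
  (P : probability T R) (Phi : R -> R) :
  nonatomic P -> orlicz_function Phi ->
  ((forall rho : (T -> R) -> \bar R,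
      no_minus_infty P Phi rho -> proper_fun P Phi rho -> convex_fun P Phi rho ->
      law_invariant P Phi rho -> norm_lsc P Phi rho -> fatou_property P Phi rho)
    <-> Delta2 Phi)
  /\
  ((forall rho : (T -> R) -> \bar R,
      no_minus_infty P Phi rho -> proper_fun P Phi rho -> quasiconvex_fun P Phi rho ->
      law_invariant P Phi rho -> norm_lsc P Phi rho -> fatou_property P Phi rho)
    <-> Delta2 Phi).
Proof.
move=> natP hPhi.
(* One convex functional refutes both statements, the quasiconvex one through
   [convex_quasiconvex]. *)
have counterexample : ~ Delta2 Phi -> exists rho : (T -> R) -> \bar R,
    [/\ no_minus_infty P Phi rho, proper_fun P Phi rho, convex_fun P Phi rho,
        law_invariant P Phi rho & norm_lsc P Phi rho] /\
    ~ fatou_property P Phi rho.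
  move=> nD; have [X [LX hX]] := exists_not_orlicz_heart natP hPhi nD.
  exists (heart_indicator P Phi); split; last exact: heart_indicator_not_fatou LX hX.
  split.
  - exact: heart_indicator_no_minus_infty.
  - exact: heart_indicator_proper.
  - exact: heart_indicator_convex.
  - exact: heart_indicator_law_invariant.
  - exact: heart_indicator_norm_lsc.
split; split.
- move=> fatou; apply: contrapT => /counterexample[rho [[? ? ? ? ?]]]; apply.
  exact: fatou.
- by move=> D2 rho *; exact: norm_lsc_fatou.
- move=> fatou; apply: contrapT => /counterexample[rho [[? ? ? ? ?]]]; apply.
  by apply: fatou => //; exact: convex_quasiconvex.
- by move=> D2 rho *; exact: norm_lsc_fatou.
Qed.
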